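(* Let $\mathcal{I}$ be an ideal on $\omega$. Then the following statements are equivalent: (a) $\mathcal{I}$ is Ramsey, that is, $\mathcal{I}^+\longrightarrow(\mathcal{I}^+)^2_2$ holds. (b) $\mathcal{I}^+\longrightarrow(\mathcal{I}^+)^n_k$ holds for all integers $n,k\geq 2$.
   Context: An ideal on a countably infinite set $X$ is a family $\mathcal{I}\subseteq\wp(X)$ containing all finite subsets of $X$, with $X\notin\mathcal{I}$, closed under taking subsets and under finite unions. $\mathcal{I}^+$ denotes the family of infinite subsets of $X$ not in $\mathcal{I}$ (the $\mathcal{I}$-positive sets). $[A]^n$ is the family of subsets of $A$ of size $n$. A set $H\subseteq A$ is homogeneous for a coloring $\pi:[A]^n\to k$ (where $k=\{0,\dots,k-1\}$) if $\pi$ is constant on $[H]^n$. For integers $n,k\ge 2$, the relation $\mathcal{I}^+\longrightarrow(\mathcal{I}^+)^n_k$ means: for every $A\in\mathcal{I}^+$ and every coloring $\pi:[A]^n\to k$ there is $B\in\mathcal{I}^+$ with $B\subseteq A$ such that $B$ is homogeneous for $\pi$. *)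

(* Defs.v *)
From mathcomp Require Import all_boot.
From mathcomp Require Import finmap.
From mathcomp Require Import boolp classical_sets functions cardinality.

Set Implicit Arguments.
Unset Strict Implicit.
Unset Printing Implicit Defensive.

Local Open Scope fset_scope.
Local Open Scope classical_set_scope.

Record is_ideal (X : choiceType) (I : set (set X)) : Prop := IsIdeal {
  ideal_finite : forall A : set X, finite_set A -> I A;
  ideal_proper : ~ I setT;
  ideal_subset : forall A B : set X, A `<=` B -> I B -> I A;
  ideal_union : forall A B : set X, I A -> I B -> I (A `|` B) }.

Definition positive (X : choiceType) (I : set (set X)) : set (set X) :=
  [set A | infinite_set A /\ ~ I A].

Definition nsubsets (X : choiceType) (A : set X) (n : nat) : set {fset X} :=
  [set s | [set` s] `<=` A /\ #|` s| = n].

Definition homogeneous (X : choiceType) (n : nat) (pi : {fset X} -> nat)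
    (H : set X) : Prop :=
  forall s t : {fset X}, nsubsets H n s -> nsubsets H n t -> pi s = pi t.

(* I^+ --> (I^+)^n_k, where [A]^n is nsubsets A n.  A coloring [A]^n -> {0, ..., k-1} is a total function
   sending [A]^n into `I_k; its values outside [A]^n play no role, since
   B `<=` A. *)
Definition arrow (X : choiceType) (I : set (set X)) (n k : nat) : Prop :=
  forall (A : set X) (pi : {fset X} -> nat),
    positive I A -> set_fun (nsubsets A n) `I_k pi ->
    exists B : set X, [/\ positive I B, B `<=` A & homogeneous n pi B].

Definition Ramsey (X : choiceType) (I : set (set X)) : Prop := arrow I 2 2.

(* Main.v *)
Require Import Defs.
From mathcomp Require Import all_boot.
From mathcomp Require Import finmap.
From mathcomp Require Import boolp classical_sets functions cardinality.

(** Only the passage from pairs to larger exponents needs an idea.  Given a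
    coloring [pi] of the [(n+1)]-subsets of a positive set, attach to every
    point [b] its type, the map [s |-> pi (b |` s)] on finite sets.  Once finite
    sets are enumerated, a type is a point of the compact space [{0..k}^nat],
    which carries the lexicographic order.

    Coloring a pair [a < b] by the lexicographic comparison of the types of [a]
    and [b], the relation for pairs gives a positive set along which the types
    are monotone; a monotone sequence converges coordinatewise
    ([lex_monotone_stabilizes]), so each finite set [s] has a limit color
    [v s] = type of [b] at [s], for all [b] beyond some bound [N s]
    ([positive_convergent]).

    Coloring a pair [a < b] by whether [b] is at least [N s] for every
    [s] included in [{0..a}] gives a positive subset so sparse that the type of
    each of its points agrees with [v] on the nonempty sets of smaller points
    ([positive_sparse]): in the other homogeneous case all points would lie
    below a bound computed from a single one.  On it, the color of an
    [(n+1)]-set, [n > 0], is the limit color of the set without its maximum,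
    and induction on [n] applies to [v] ([arrow_succ]).

    An ideal need not be maximal, so there is no majority color with which to
    define [v] directly, as one would for an ultrafilter; monotonicity along a
    positive set takes its place. *)

Local Open Scope fset_scope.
Local Open Scope classical_set_scope.

(** * Finite and infinite sets of natural numbers *)

Lemma infinite_unbounded {B : set nat} (N : nat) :
  infinite_set B -> exists2 b, B b & N <= b.
Proof.
move=> infB; apply: contrapT => noB; apply: infB.
apply: (@sub_finite_set _ _ `I_N); last exact: finite_II.
move=> b Bb /=; rewrite ltnNge; apply/negP => leNb; apply: noB.
by exists b.
Qed.

Lemma fset_nat_max (s : {fset nat}) :
  s != fset0 -> exists2 b, b \in s & forall x, x \in s -> x <= b.
Proof.
move=> /fset0Pn exs.
have bnd x : x \in s -> x <= \max_(y <- s) y.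
  by move=> xs; apply: (@leq_bigmax_seq _ _ xpredT (fun y => y)).
by case: (ex_maxnP exs bnd) => b bs maxb; exists b.
Qed.

Lemma nsubsets_remove_max (A : set nat) n (s : {fset nat}) :
  nsubsets A n.+1 s ->
  exists b (r : {fset nat}), [/\ s = (b |` r)%fset, A b, nsubsets A n r
    & forall x, x \in r -> x < b].
Proof.
case=> sA cs.
have [|b bs maxb] := @fset_nat_max s; first by rewrite -cardfs_gt0 cs.
exists b, (s `\ b)%fset; split.
- by rewrite fsetD1K.
- exact: sA.
- split; first by move=> x /=; rewrite in_fsetD1 => /andP[_ /sA].
  by move: cs; rewrite (cardfsD1 b) bs add1n => -[].
- by move=> x; rewrite in_fsetD1 => /andP[xb xs]; rewrite ltn_neqAle xb maxb.
Qed.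

(** * Lexicographically monotone sequences *)

(** A sequence, indexed by [B], of points of [{0..K}^nat] that is weakly
    increasing for the lexicographic order.  The hypothesis [mono] is the trace
    of that order on coordinate [i].  Once the coordinates below [i] are
    frozen, coordinate [i] is monotone and bounded, hence becomes frozen too. *)
Lemma lex_increasing_stabilizes {B : set nat} {t : nat -> nat -> nat} {K} :
  infinite_set B -> (forall b i, t b i <= K) ->
  (forall a b i, B a -> B b -> a < b ->
    (forall j, j < i -> t a j = t b j) -> t a i <= t b i) ->
  forall i, exists N, forall a b, B a -> B b -> N <= a -> N <= b ->
    forall j, j < i -> t a j = t b j.
Proof.
move=> infB tK mono; elim=> [|i [N agree]]; first by exists 0.
pose P m := `[< exists b, [/\ B b, N <= b & t b i = m] >].
have exP : exists m, P m.
  by have [b Bb Nb] := infinite_unbounded N infB; exists (t b i); apply/asboolP; exists b.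
have bP m : P m -> m <= K by move=> /asboolP[b [_ _ <-]].
case: (ex_maxnP exP bP) => m /asboolP[b0 [Bb0 Nb0 tb0]] maxm.
have eqm a : B a -> b0 <= a -> t a i = m.
  move=> Ba b0a; have Na := leq_trans Nb0 b0a.
  apply/eqP; rewrite eqn_leq maxm /=; last by apply/asboolP; exists a.
  move: b0a; rewrite leq_eqVlt => /predU1P[<-|ltb0a]; first by rewrite tb0.
  rewrite -tb0; apply: mono => // j ji; exact: agree.
exists b0 => a b Ba Bb b0a b0b j; rewrite ltnS leq_eqVlt => /predU1P[->|ji].
  by rewrite !eqm.
by apply: agree => //; apply: leq_trans Nb0 _.
Qed.

Definition lex_lt (x y : nat -> nat) : Prop :=
  exists2 i, (forall j, j < i -> x j = y j) & x i < y i.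

Lemma lex_lt_coord {x y : nat -> nat} {i} :
  lex_lt x y -> (forall j, j < i -> x j = y j) -> x i <= y i.
Proof.
move=> [i0 eq0 lt0] eqi; case: (ltngtP i i0) => [ii0|i0i|->].
- by rewrite eq0.
- by move: lt0; rewrite eqi // ltnn.
- exact: ltnW.
Qed.

Lemma lex_monotone_stabilizes {B : set nat} {t : nat -> nat -> nat} {K} :
  infinite_set B -> (forall b i, t b i <= K) ->
  (forall a b, B a -> B b -> a < b -> lex_lt (t a) (t b)) \/
  (forall a b, B a -> B b -> a < b -> ~ lex_lt (t a) (t b)) ->
  forall i, exists N, forall a b, B a -> B b -> N <= a -> N <= b ->
    t a i = t b i.
Proof.
move=> infB tK tmono i.
suff [N HN] : exists N, forall a b, B a -> B b -> N <= a -> N <= b ->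
    forall j, j < i.+1 -> t a j = t b j.
  by exists N => a b Ba Bb Na Nb; apply: HN.
case: tmono => [incr|nincr].
  apply: (@lex_increasing_stabilizes _ _ K) => // a b l Ba Bb ab.
  exact: lex_lt_coord (incr _ _ Ba Bb ab).
(* Reflecting every coordinate turns a decreasing sequence into an increasing
   one. *)
have inj a b l : K - t a l = K - t b l -> t a l = t b l.
  by move=> e; rewrite -(subKn (tK a l)) e subKn.
have [|a b l Ba Bb ab eql|N HN] :=
    @lex_increasing_stabilizes B (fun b l => K - t b l) K infB _ _ i.+1.
- by move=> b l; exact: leq_subr.
- apply: leq_sub2l; rewrite leqNgt; apply/negP => lt_l.
  by apply: (nincr a b) => //; exists l => // j jl; apply: inj; apply: eql.
- by exists N => a b Ba Bb Na Nb j ji; apply: inj; apply: HN.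
Qed.

(** * Applications of the relation for pairs *)

Section RamseyIdeal.

Variables (I : set (set nat)) (ramI : Ramsey I).

(** A coloring of unordered pairs of numbers can use the increasing order of
    the two points, so a relation [R], symmetric or not, can be made constant
    on increasing pairs. *)
Lemma Ramsey_rel (R : nat -> nat -> Prop) (A : set nat) :
  positive I A ->
  exists B, [/\ positive I B, B `<=` A
    & (forall a b, B a -> B b -> a < b -> R a b) \/
      (forall a b, B a -> B b -> a < b -> ~ R a b)].
Proof.
move=> posA.
pose P (s : {fset nat}) := exists a b, [/\ a < b, s = [fset a; b] & R a b].
pose pi (s : {fset nat}) : nat := `[< P s >].
have [|B [posB BA homB]] := ramI A pi posA.
  by move=> s _ /=; rewrite /pi; case: `[< _ >].
have PE a b : a < b -> P [fset a; b] -> R a b.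
  move=> ab [c [d [cd E Rcd]]].
  have mem x : (x == a) || (x == b) = (x == c) || (x == d).
    by rewrite -!in_fset2 E.
  have /orP ca : (c == a) || (c == b) by rewrite mem eqxx.
  have /orP da : (d == a) || (d == b) by rewrite mem eqxx orbT.
  case: ca da cd => /eqP cE [] /eqP dE; subst c d; rewrite ?ltnn // => ba.
  by move: (ltn_trans ab ba); rewrite ltnn.
have pairB a b : B a -> B b -> a < b -> nsubsets B 2 [fset a; b].
  move=> Ba Bb ab; split; last by rewrite cardfs2 neq_ltn ab.
  by move=> x /=; rewrite in_fset2 => /orP[] /eqP ->.
exists B; split => //.
case: (pselect (exists a b, [/\ B a, B b, a < b & R a b])) => [|noR].
  move=> [a [b [Ba Bb ab Rab]]]; left=> c d Bc Bd cd; apply: PE => //.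
  have := homB _ _ (pairB _ _ Ba Bb ab) (pairB _ _ Bc Bd cd).
  have Pab : P [fset a; b] by exists a, b.
  by rewrite /pi (asboolT Pab); case: asboolP.
by right=> a b Ba Bb ab Rab; apply: noR; exists a, b.
Qed.

(** Two points of different colors in every pair would make the coloring
    injective on an infinite set. *)
Lemma arrow_points k : arrow I 1 k.
Proof.
move=> A pi posA piK.
have [B [posB BA [eqB|neqB]]] :=
  Ramsey_rel (fun a b => pi [fset a] = pi [fset b]) A posA; last first.
  exfalso; case: posB => infB _; apply: infB.
  have inj : {in B &, injective (fun b => pi [fset b])}.
    move=> a b /set_mem Ba /set_mem Bb e; case: (ltngtP a b) => // ab.
      by case: (neqB _ _ Ba Bb ab).
    by case: (neqB _ _ Bb Ba ab).
  rewrite -(eq_finite_set (inj_card_eq inj)).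
  apply: (@sub_finite_set _ _ `I_k); last exact: finite_II.
  move=> _ [b Bb <-]; apply: piK; split; last by rewrite cardfs1.
  by move=> x /=; rewrite in_fset1 => /eqP ->; exact: BA.
have single s : nsubsets B 1 s -> exists2 b, B b & s = [fset b].
  case=> sB /eqP/cardfs1P[b sE]; exists b => //.
  by apply: sB; rewrite /= sE fset11.
exists B; split=> // s t /single[a Ba ->] /single[b Bb ->].
case: (ltngtP a b) => [ab|ba|->//]; first exact: eqB.
exact/esym/eqB.
Qed.

(** Sequential compactness of [{0..K}^nat] with a positive set of indices:
    lexicographic comparison turns the relation for pairs into the existence of
    monotone, hence convergent, subsequences. *)
Lemma positive_convergent (A : set nat) (t : nat -> {fset nat} -> nat) K :
  positive I A -> (forall b s, t b s <= K) ->
  exists B N v, [/\ positive I B, B `<=` A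
    & forall s b, B b -> N s <= b -> t b s = v s].
Proof.
move=> posA tK.
pose u b i := if choice.unpickle i is Some s then t b s else 0.
have uK b i : u b i <= K by rewrite /u; case: choice.unpickle.
have [B [posB BA monoB]] := Ramsey_rel (fun a b => lex_lt (u a) (u b)) A posA.
have infB : infinite_set B by case: posB.
have stab s : exists p : nat * nat, forall b, B b -> p.1 <= b -> t b s = p.2.
  have [N HN] := lex_monotone_stabilizes infB uK monoB (choice.pickle s).
  have [b0 Bb0 Nb0] := infinite_unbounded N infB.
  exists (N, t b0 s) => b Bb /= Nb.
  by have := HN b b0 Bb Bb0 Nb Nb0; rewrite /u choice.pickleK.
have [p Hp] := choice stab.
by exists B, (fst \o p), (snd \o p); split => // s b; apply: Hp.
Qed.

(** In the other homogeneous case, for a fixed element [a], no point would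
    exceed both [a] and the maximum of [N] on the finitely many subsets of
    [{0..a}]. *)
Lemma positive_sparse (A : set nat) (N : {fset nat} -> nat) :
  positive I A ->
  exists B, [/\ positive I B, B `<=` A
    & forall a b (s : {fset nat}), B a -> B b -> a < b ->
        (forall x, x \in s -> x <= a) -> N s <= b].
Proof.
move=> posA.
pose R a b := forall s : {fset nat}, (forall x, x \in s -> x <= a) -> N s <= b.
have [B [posB BA [sparse|dense]]] := Ramsey_rel R A posA.
  by exists B; split => // a b s Ba Bb ab; apply: sparse.
exfalso; case: posB => infB _.
have [a Ba _] := infinite_unbounded 0 infB.
pose below := [fset x in iota 0 a.+1].
pose M := \max_(s <- fpowerset below) N s.
have [b Bb] := infinite_unbounded (maxn a.+1 M) infB.
rewrite geq_max => /andP[ab Mb]; apply: (dense a b) => // s sa.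
apply: leq_trans Mb; apply: leq_bigmax_seq => //.
rewrite fpowersetE; apply/fsubsetP => x xs.
by rewrite in_fset mem_iota add0n ltnS sa.
Qed.

(** The induction step applies the hypothesis to the limit coloring. It takes
    values in [{0..k}], one more than [pi], because types are truncated at
    [k]: this keeps them bounded also where [pi] is unconstrained. *)
Lemma arrow_succ n : (forall k, arrow I n.+1 k) -> forall k, arrow I n.+2 k.
Proof.
move=> IHn k A pi posA piK.
pose t b (s : {fset nat}) := minn (pi (b |` s)%fset) k.
have tk b s : t b s <= k by exact: geq_minr.
have [B [N [v [posB BA lim]]]] := positive_convergent A t k posA tk.
have [C [posC CB sparse]] := positive_sparse B N posB.
have [|D [posD DC homD]] := IHn k.+1 C v posC.
  move=> s _ /=; have [b Bb Nb] := infinite_unbounded (N s) (proj1 posB).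
  by rewrite -(lim s b) // ltnS.
have DA : D `<=` A by move=> x /DC /CB /BA.
have piE s : nsubsets D n.+2 s ->
    exists2 r, nsubsets D n.+1 r & pi s = v r.
  move=> Ds; have [b [r [sE Db Dr ltb]]] := nsubsets_remove_max _ _ _ Ds.
  exists r => //.
  have [a [q [rE Da _ lta]]] := nsubsets_remove_max _ _ _ Dr.
  have ar : a \in r by rewrite rE fset1U1.
  have maxa x : x \in r -> x <= a.
    by rewrite rE in_fset1U => /predU1P[->//|/lta/ltnW].
  rewrite -(lim r b); first last.
  - by apply: (sparse a) => //; [exact: DC|exact: DC|exact: ltb].
  - exact/CB/DC.
  rewrite /t -sE; apply/esym/minn_idPl/ltnW.
  apply: piK; case: Ds => sD cs; split => // x /sD; exact: DA.
exists D; split => // s s' /piE[r Dr ->] /piE[r' Dr' ->]; exact: homD.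
Qed.

Lemma Ramsey_arrow n k : arrow I n.+1 k.
Proof.
elim: n k => [|n IHn] k; [exact: arrow_points | exact: arrow_succ].
Qed.

End RamseyIdeal.

Theorem theorem3p13 (I : set (set nat)) (hI : is_ideal I) :
  Ramsey I <-> (forall n k : nat, 2 <= n -> 2 <= k -> arrow I n k).
Proof.
split=> [ramI [//|n] k _ _|arrowI]; first exact: Ramsey_arrow.
exact: arrowI.
Qed.
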